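(* Let $n_1,\dots,n_C\ge1$ be integers with $\sum_c n_c=m$, let $L_{SC}=\mathrm{blkdiag}(L_1,\dots,L_C)$ with $L_c=n_c\mathbb I_{n_c}-\mathbf 1_{n_c}\mathbf 1_{n_c}^{T}$, let $\rho\in(0,1]$, $A_\rho=\mathbb I_m+\frac{1-\rho}{\rho}L_{SC}$, $\theta\in\mathbb{R}^m$, and $\theta^{SC}=A_\rho^{-1}\theta$. Let $W\in\mathbb{R}^{k\times m}$ have full row rank $k\le m$ and let $p\in\mathbb{R}^k$. Then, by the Karush–Kuhn–Tucker conditions, the solution of the convex problem $$\underset{\vartheta\in\mathbb{R}^m}{\text{minimize}}\;\;\rho(\vartheta-\theta)^{T}(\vartheta-\theta)+(1-\rho)\,\vartheta^{T}L_{SC}\,\vartheta\qquad\text{subject to } W\vartheta=p$$ is $$\theta^{SC\text{-}B}=\theta^{SC}+A_\rho^{-1}W^{T}\left(WA_\rho^{-1}W^{T}\right)^{-1}\left(p-W\theta^{SC}\right).$$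
   Context: $\mathbb I_k$ is the $k\times k$ identity, $\mathbf 1_k$ the column vector of $k$ ones, $\mathrm{blkdiag}$ the block-diagonal matrix with given blocks. The $m$ small areas are partitioned into $C$ clusters of sizes $n_c$; $\theta=\mu+Zu$ is the small area parameter vector of a linear mixed model; $W\vartheta=p$ are external linear benchmarking constraints. *)

(* Defs.v *)
From HB Require Import structures.
From mathcomp Require Import all_boot all_order all_algebra.
From mathcomp Require Import all_classical reals.
From mathcomp Require Import convex.

Set Implicit Arguments.
Unset Strict Implicit.
Unset Printing Implicit Defensive.

Import Order.TTheory GRing.Theory Num.Theory.
Local Open Scope classical_set_scope.
Local Open Scope ring_scope.

Definition ones {R : realType} (k : nat) : 'cV[R]_k := const_mx 1.

Definition cluster_laplacian {R : realType} (k : nat) : 'M[R]_k :=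
  (k%:R)%:M - ones k *m (ones k)^T.

(* The number of areas m is [\sum_c n c], which is the dimension of
   [\mxdiag_c]; hence no cast is needed. *)
Definition L_SC {R : realType} (C : nat) (n : 'I_C -> nat) :
    'M[R]_(\sum_c n c) :=
  \mxdiag_c cluster_laplacian (n c).

Definition A_SC {R : realType} (C : nat) (n : 'I_C -> nat) (rho : R) :
    'M[R]_(\sum_c n c) :=
  1%:M + ((1 - rho) / rho) *: L_SC n.

Definition theta_SC {R : realType} (C : nat) (n : 'I_C -> nat) (rho : R)
    (theta : 'cV[R]_(\sum_c n c)) : 'cV[R]_(\sum_c n c) :=
  invmx (A_SC n rho) *m theta.

Definition theta_SC_B {R : realType} (C : nat) (n : 'I_C -> nat) (rho : R)
    (theta : 'cV[R]_(\sum_c n c)) (k : nat)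
    (W : 'M[R]_(k, \sum_c n c)) (p : 'cV[R]_k) : 'cV[R]_(\sum_c n c) :=
  theta_SC rho theta
  + invmx (A_SC n rho) *m W^T *m invmx (W *m invmx (A_SC n rho) *m W^T)
    *m (p - W *m theta_SC rho theta).

(* [0 0] extracts the only entry of a 1 x 1 matrix. *)
Definition SC_objective {R : realType} (C : nat) (n : 'I_C -> nat) (rho : R)
    (theta v : 'cV[R]_(\sum_c n c)) : R :=
  rho * ((v - theta)^T *m (v - theta)) 0 0
  + (1 - rho) * (v^T *m L_SC n *m v) 0 0.

Definition benchmarked {R : realType} (m k : nat)
    (W : 'M[R]_(k, m)) (p : 'cV[R]_k) : set 'cV[R]_m :=
  [set v | W *m v = p].

Definition minimizes {R : realType} (T : Type) (f : T -> R) (D : set T)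
    (x : T) : Prop :=
  D x /\ forall y, D y -> f x <= f y.

(* Main.v *)
(** For rho > 0 the objective is rho times the quadratic function
    [v^T A_rho v - 2 v^T theta + theta^T theta], and A_rho is positive definite
    because [2 x^T L_c x = \sum_(i, j) (x_i - x_j)^2].  The second-order expansion
    of the objective is exact, with gradient [2 rho (A_rho v - theta)]; at the
    claimed solution this gradient lies in the row space of W (stationarity of
    the Lagrangian), so it vanishes on differences of feasible points, and only
    the positive definite second-order term is left. *)
Require Import Defs.
From HB Require Import structures.
From mathcomp Require Import all_boot all_order all_algebra.
From mathcomp Require Import all_classical reals.
From mathcomp Require Import convex.
From mathcomp Require Import interval_inference.
From mathcomp Require Import ring.

Set Implicit Arguments.
Unset Strict Implicit.
Unset Printing Implicit Defensive.

Import Order.TTheory GRing.Theory Num.Theory.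
Local Open Scope classical_set_scope.
Local Open Scope ring_scope.

(** * Quadratic forms and positive definite matrices *)

Definition qform {R : pzRingType} (m : nat) (M : 'M[R]_m) (x : 'cV[R]_m) : R :=
  (x^T *m M *m x) 0 0.

Definition posdefmx {R : realFieldType} (m : nat) (M : 'M[R]_m) : Prop :=
  M^T = M /\ forall x : 'cV[R]_m, x != 0 -> 0 < qform M x.

Lemma mx11_tr {R : Type} (M : 'M[R]_1) : M^T = M.
Proof. by apply/matrixP => i j; rewrite mxE !ord1. Qed.

Lemma qform1 (R : pzRingType) (m : nat) (x : 'cV[R]_m) :
  qform 1%:M x = \sum_i x i 0 ^+ 2.
Proof.
by rewrite /qform mulmx1 mxE; apply: eq_bigr => i _; rewrite mxE -expr2.
Qed.

Lemma qformD (R : pzRingType) (m : nat) (M N : 'M[R]_m) x :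
  qform (M + N) x = qform M x + qform N x.
Proof. by rewrite /qform mulmxDr mulmxDl mxE. Qed.

Lemma qformZ (R : comPzRingType) (m : nat) a (M : 'M[R]_m) x :
  qform (a *: M) x = a * qform M x.
Proof. by rewrite /qform -scalemxAr -scalemxAl mxE. Qed.

Lemma qformZr (R : comPzRingType) (m : nat) a (M : 'M[R]_m) x :
  qform M (a *: x) = a ^+ 2 * qform M x.
Proof.
by rewrite /qform [(a *: x)^T]linearZ/= -!scalemxAl -scalemxAr scalerA mxE -expr2.
Qed.

Lemma qform_mulmx (R : comPzRingType) (m k : nat) (M : 'M[R]_m)
    (B : 'M[R]_(m, k)) x :
  qform M (B *m x) = qform (B^T *m M *m B) x.
Proof. by rewrite /qform trmx_mul !mulmxA. Qed.

Lemma qform_ge0 (R : realFieldType) (m : nat) (M : 'M[R]_m) x :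
  posdefmx M -> 0 <= qform M x.
Proof.
move=> [_ M_gt0]; have [->|/M_gt0/ltW //] := eqVneq x 0.
by rewrite /qform mulmx0 mxE.
Qed.

Lemma posdefmx1D (R : realFieldType) (m : nat) (N : 'M[R]_m) :
  N^T = N -> (forall x, 0 <= qform N x) -> posdefmx (1%:M + N).
Proof.
move=> N_sym N_ge0; split=> [|x x_neq0].
  by rewrite linearD/= trmx1 N_sym.
rewrite qformD ltr_wpDr// qform1 lt_neqAle eq_sym.
rewrite sumr_ge0 ?andbT => [|i _]; last exact: sqr_ge0.
apply: contra x_neq0; rewrite psumr_eq0 => [/allP xP|i _]; last exact: sqr_ge0.
apply/eqP/matrixP => i j; rewrite ord1 mxE; apply/eqP.
by rewrite -sqrf_eq0; apply: xP; rewrite mem_index_enum.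
Qed.

(** A row vector [v] with [v *m M = 0] makes the form vanish at [v^T], so the left kernel is
    trivial. *)
Lemma posdefmx_unit (R : realFieldType) (m : nat) (M : 'M[R]_m) :
  posdefmx M -> M \in unitmx.
Proof.
move=> [M_sym M_gt0]; rewrite -row_free_unit; apply: inj_row_free => v vM.
apply/eqP; rewrite -trmx_eq0; apply: contraT => /M_gt0.
by rewrite /qform trmxK vM mul0mx mxE ltxx.
Qed.

(** The substitution [x = M *m y] turns the form of the inverse at [x] into the form of [M] at
    [y]. *)
Lemma posdefmx_inv (R : realFieldType) (m : nat) (M : 'M[R]_m) :
  posdefmx M -> posdefmx (invmx M).
Proof.
move=> M_pd; have M_unit := posdefmx_unit M_pd; have [M_sym M_gt0] := M_pd.
have Mi_sym : (invmx M)^T = invmx M by rewrite trmx_inv M_sym.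
split=> // x x_neq0.
have -> : qform (invmx M) x = qform M (invmx M *m x).
  by rewrite qform_mulmx Mi_sym mulVmx ?mul1mx.
apply: M_gt0; apply: contra x_neq0 => /eqP /(congr1 (mulmx M)).
by rewrite mulKVmx// mulmx0 => ->.
Qed.

(** Full row rank makes [W^T] injective on columns. Applied to the inverse of [A_SC], this makes the
    matrix inverted in [theta_SC_B] positive definite. *)
Lemma posdefmx_congr (R : realFieldType) (m k : nat) (M : 'M[R]_m)
    (W : 'M[R]_(k, m)) :
  posdefmx M -> row_free W -> posdefmx (W *m M *m W^T).
Proof.
move=> [M_sym M_gt0] W_free; split=> [|x x_neq0].
  by rewrite !trmx_mul trmxK M_sym mulmxA.
have := M_gt0 (W^T *m x); rewrite qform_mulmx trmxK; apply.
by rewrite -trmx_eq0 trmx_mul trmxK mulmx_free_eq0 // trmx_eq0.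
Qed.

(** * The cluster Laplacians and [A_SC] *)

Lemma trmx_cluster_laplacian (R : realType) (k : nat) :
  (cluster_laplacian k : 'M[R]_k)^T = cluster_laplacian k.
Proof. by rewrite linearB/= tr_scalar_mx trmx_mul trmxK. Qed.

(** Both sides equal twice [k * \sum_i x_i ^+ 2 - (\sum_i x_i) ^+ 2]; the factor 2 appears because
    each unordered pair is counted twice. *)
Lemma qform_cluster_laplacian (R : realType) (k : nat) (x : 'cV[R]_k) :
  2 * qform (cluster_laplacian k) x =
  \sum_i \sum_j (x i 0 - x j 0) ^+ 2.
Proof.
have -> : qform (cluster_laplacian k) x =
    k%:R * (\sum_i x i 0 ^+ 2) - (\sum_i x i 0) ^+ 2.
  rewrite /cluster_laplacian -scaleN1r qformD qformZ mulN1r -scalemx1 qformZ qform1; congr (_ - _).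
  have onesP : ((ones k)^T *m x) 0 0 = \sum_i x i 0.
    by rewrite mxE; apply: eq_bigr => i _; rewrite !mxE mul1r.
  have -> : qform (ones k *m (ones k)^T) x = qform 1%:M ((ones k)^T *m x).
    by rewrite qform_mulmx trmxK mulmx1.
  by rewrite qform1 big_ord1 onesP.
have -> : \sum_i \sum_j (x i 0 - x j 0) ^+ 2 =
    \sum_i (k%:R * x i 0 ^+ 2 - 2 * x i 0 * (\sum_j x j 0)
            + \sum_j x j 0 ^+ 2).
  apply: eq_bigr => i _; rewrite mulr_sumr.
  rewrite (_ : k%:R * _ = \sum_(j < k) x i 0 ^+ 2); last first.
    by rewrite sumr_const card_ord mulr_natl.
  by rewrite -sumrB -big_split/=; apply: eq_bigr => j _; ring.
rewrite big_split/= sumrB -mulr_sumr -mulr_suml -mulr_sumr.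
by rewrite sumr_const card_ord -mulr_natl; ring.
Qed.

Lemma cluster_laplacian_ge0 (R : realType) (k : nat) (x : 'cV[R]_k) :
  0 <= qform (cluster_laplacian k) x.
Proof.
rewrite -(pmulr_rge0 _ (ltr0n R 2)) qform_cluster_laplacian.
by apply: sumr_ge0 => i _; apply: sumr_ge0 => j _; apply: sqr_ge0.
Qed.

Lemma qform_mxdiag (R : pzRingType) (C : nat) (n : 'I_C -> nat)
    (D : forall c, 'M[R]_(n c)) (x : 'cV[R]_(\sum_c n c)) :
  qform (\mxdiag_c D c) x = \sum_c qform (D c) (submxcol x c).
Proof.
rewrite /qform -{1 2}(submxcolK x) tr_mxcol mul_mxrow_mxdiag mul_mxrow_mxcol.
by rewrite summxE.
Qed.

Lemma trmx_L_SC (R : realType) (C : nat) (n : 'I_C -> nat) :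
  (L_SC n : 'M[R]__)^T = L_SC n.
Proof.
by rewrite /L_SC tr_mxdiag; apply: eq_mxdiag => c; apply: trmx_cluster_laplacian.
Qed.

Lemma trmx_A_SC (R : realType) (C : nat) (n : 'I_C -> nat) (rho : R) :
  (A_SC n rho)^T = A_SC n rho.
Proof. by rewrite linearD linearZ/= trmx1 trmx_L_SC. Qed.

Lemma posdefmx_A_SC (R : realType) (C : nat) (n : 'I_C -> nat) (rho : R) :
  0 < rho -> rho <= 1 -> posdefmx (A_SC n rho).
Proof.
move=> rho_gt0 rho_le1; apply: posdefmx1D => [|x].
  by rewrite linearZ/= trmx_L_SC.
rewrite qformZ mulr_ge0 //; first by rewrite divr_ge0 ?subr_ge0// ltW.
by rewrite qform_mxdiag sumr_ge0 // => c _; apply: cluster_laplacian_ge0.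
Qed.

(** * Expansion and convexity of the objective *)

Lemma SC_objectiveE (R : realType) (C : nat) (n : 'I_C -> nat) (rho : R)
    (theta v : 'cV[R]_(\sum_c n c)) : rho != 0 ->
  SC_objective rho theta v =
  rho * (qform (A_SC n rho) v - 2 * (v^T *m theta) 0 0
         + (theta^T *m theta) 0 0).
Proof.
move=> rho_neq0; rewrite qformD qformZ /SC_objective /qform mulmx1.
have -> : (v - theta)^T *m (v - theta) =
    v^T *m v - v^T *m theta - v^T *m theta + theta^T *m theta.
  rewrite [(v - theta)^T]linearB/= mulmxBl !mulmxBr.
  (* A 1 x 1 matrix is its own transpose, so the two cross terms agree. *)
  have -> : theta^T *m v = v^T *m theta.
    by rewrite -[LHS]mx11_tr trmx_mul trmxK.
  by rewrite opprB [in LHS](addrC (theta^T *m theta)) addrA.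
by rewrite ![(_ + _ : 'M_1) 0 0]mxE ![(- _ : 'M_1) 0 0]mxE; field.
Qed.

Lemma SC_objectiveD (R : realType) (C : nat) (n : 'I_C -> nat) (rho : R)
    (theta v h : 'cV[R]_(\sum_c n c)) : rho != 0 ->
  SC_objective rho theta (v + h) = SC_objective rho theta v
    + 2 * rho * (h^T *m (A_SC n rho *m v - theta)) 0 0
    + rho * qform (A_SC n rho) h.
Proof.
move=> rho_neq0; rewrite !SC_objectiveE //.
move: (A_SC n rho) (trmx_A_SC n rho) => A A_sym.
have -> : qform A (v + h) = qform A v + qform A h + 2 * (h^T *m (A *m v)) 0 0.
  rewrite /qform [(v + h)^T]linearD/= !mulmxDl !mulmxDr.
  (* Symmetry of [A] merges the two cross terms into one gradient term. *)
  have -> : v^T *m A *m h = h^T *m A *m v.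
    by rewrite -[LHS]mx11_tr !trmx_mul trmxK A_sym mulmxA.
  by rewrite mulmxA ![(_ + _ : 'M_1) 0 0]mxE; ring.
rewrite [(v + h)^T]linearD/= mulmxDl mulmxBr [(_ + h^T *m theta) 0 0]mxE.
by rewrite [(_ - h^T *m theta) 0 0]mxE [(- (h^T *m theta)) 0 0]mxE; ring.
Qed.

(** Both endpoints are expanded around their convex combination [z]. The linear terms cancel in the
    weighted average, which leaves a nonnegative multiple of the form at [x - y]. *)
Lemma convex_SC_objective (R : realType) (C : nat) (n : 'I_C -> nat) (rho : R)
    (theta : 'cV[R]_(\sum_c n c)) :
  0 < rho -> rho <= 1 -> convex_function setT (SC_objective rho theta).
Proof.
move=> rho_gt0 rho_le1 t x y _ _.
have rho_neq0 : rho != 0 by rewrite gt_eqF.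
have q_ge0 := qform_ge0 (x - y) (posdefmx_A_SC n rho_gt0 rho_le1).
have [t_ge0 t_le1] : 0 <= t%:num /\ t%:num <= 1 by [].
rewrite convRE; move: t_ge0 t_le1.
set z : 'cV[R]_(\sum_c n c) := conv t x y.
have xE : x = z + (1 - t%:num) *: (x - y).
  rewrite [z]/(t%:num *: (x : 'cV_(_)) + (1 - t%:num) *: (y : 'cV_(_))).
  by rewrite scalerBr addrACA subrr addr0 -scalerDl addrC subrK scale1r.
have yE : y = z + (- t%:num) *: (x - y).
  rewrite [LHS](_ : y = x - (x - y)); last by rewrite subKr.
  rewrite {1}xE -addrA; congr (_ + _).
  by rewrite -{2}[x - y]scale1r -scalerBl; congr (_ *: _); ring.
clearbody z.
(* Only the argument of the objective is replaced, since [x] also occurs in the right-hand side of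
   [xE]. *)
have -> : SC_objective rho theta x =
  SC_objective rho theta (z + (1 - t%:num) *: (x - y)) by rewrite -xE.
have -> : SC_objective rho theta y =
  SC_objective rho theta (z + (- t%:num) *: (x - y)) by rewrite -yE.
rewrite !SC_objectiveD// !qformZr ![((_ *: _)^T)]linearZ/= -!scalemxAl.
move: q_ge0; set q := qform _ _; set g := _^T *m _.
rewrite ![(_ *: g) 0 0]mxE /unstable.onem.
move: (SC_objective _ _ z) (g 0 0) (t%:num) => F G a q_ge0 a_ge0 a_le1.
rewrite -subr_ge0.
(* The coefficient comes from [a * (1 - a) ^+ 2 + (1 - a) * a ^+ 2 = a * (1 - a)]. *)
have -> : a * (F + 2 * rho * ((1 - a) * G) + rho * ((1 - a) ^+ 2 * q))
    + (1 - a) * (F + 2 * rho * (- a * G) + rho * ((- a) ^+ 2 * q)) - F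
  = rho * (a * (1 - a)) * q by ring.
by rewrite !mulr_ge0 ?subr_ge0// ltW.
Qed.

Lemma convex_benchmarked (R : realType) (m k : nat) (W : 'M[R]_(k, m)) p :
  convex_set (benchmarked W p).
Proof.
move=> x y t; rewrite !inE /benchmarked/= => Wx Wy.
rewrite [conv t x y]/(t%:num *: (x : 'cV_(_)) + (1 - t%:num) *: (y : 'cV_(_))).
rewrite mulmxDr -!scalemxAr Wx Wy -scalerDl.
by rewrite addrC subrK scale1r.
Qed.

(** * The constrained minimiser *)

Theorem proposition3p1 (R : realType) (C : nat) (n : 'I_C -> nat)
    (n_ge1 : forall c, (1 <= n c)%N)
    (rho : R) (rho_gt0 : 0 < rho) (rho_le1 : rho <= 1)
    (theta : 'cV[R]_(\sum_c n c))
    (k : nat) (k_le_m : (k <= \sum_c n c)%N)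
    (W : 'M[R]_(k, \sum_c n c)) (W_full_row_rank : row_free W)
    (p : 'cV[R]_k) :
  [/\ (* the problem is convex *)
      convex_function setT (SC_objective rho theta)
        /\ convex_set (benchmarked W p),
      (* the inverses in the formulas exist *)
      A_SC n rho \in unitmx,
      W *m invmx (A_SC n rho) *m W^T \in unitmx
    & (* the formula gives the solution, which is unique *)
      forall v : 'cV[R]_(\sum_c n c),
        minimizes (SC_objective rho theta) (benchmarked W p) v
        <-> v = theta_SC_B rho theta W p].
Proof.
have rho_neq0 : rho != 0 by rewrite gt_eqF.
have A_pd := posdefmx_A_SC n rho_gt0 rho_le1.
have A_unit := posdefmx_unit A_pd.
have S_unit := posdefmx_unit (posdefmx_congr (posdefmx_inv A_pd) W_full_row_rank).
split=> //; first split.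
- exact: convex_SC_objective.
- exact: convex_benchmarked.
set s := theta_SC_B rho theta W p.
have s_feasible : benchmarked W p s.
  by rewrite /benchmarked/= /s /theta_SC_B mulmxDr !mulmxA mulmxV// mul1mx addrC subrK.
(* This exact gap yields both directions: its nonnegativity gives optimality of [s], its strict
   positivity off [s] gives uniqueness. *)
have excess y : benchmarked W p y ->
    SC_objective rho theta y =
    SC_objective rho theta s + rho * qform (A_SC n rho) (y - s).
  move=> Wy; rewrite -{1}(subrK s y) addrC SC_objectiveD//.
  (* Stationarity: the factor after [W^T] is the Lagrange multiplier, up to sign and the factor
     [2 * rho]. *)
  have -> : A_SC n rho *m s - theta =
      W^T *m (invmx (W *m invmx (A_SC n rho) *m W^T)
              *m (p - W *m theta_SC rho theta)).
    rewrite /s /theta_SC_B mulmxDr [A_SC n rho *m theta_SC _ _]mulKVmx//.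
    by rewrite addrC addKr !mulmxA mulmxV// mul1mx.
  (* The gradient term contains [(W *m (y - s))^T], which is zero because both points are
     feasible. *)
  rewrite mulmxA -trmx_mul mulmxBr Wy s_feasible subrr.
  by rewrite trmx0 mul0mx [(0 : 'M_1) 0 0]mxE mulr0 addr0.
split=> [[Wv v_min]|->].
  apply/eqP; rewrite -subr_eq0; apply: contraT => /A_pd.2 vs_gt0.
  have := v_min s s_feasible.
  by rewrite excess// gerDl leNgt mulr_gt0.
split=> // y /excess ->.
by rewrite lerDl mulr_ge0 ?qform_ge0// ltW.
Qed.
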